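(* Let $\mathcal{E}=\{e_1,\dots,e_{n+1}\}$ be a basis of $\mathbb{R}^{n+1}$, let $\|\cdot\|$ be a norm on $\mathbb{R}^{n+1}$, and let $\alpha$ be the $(n+1)$-bonacci number, i.e. the root of largest modulus of the equation $x^{n+1}=x^n+\cdots+x+1$. (1) For every Fibonacci section $(t_k)_{k\ge1}$ of $T(\mathcal{E})$, the norms of the barycenters grow like $\alpha^k$: there are constants $0<c\le C$ such that $c\,\alpha^k\le\|b(t_k)\|\le C\,\alpha^k$ for all $k\ge1$. (2) This is the highest growth rate on a section of $T(\mathcal{E})$: for every section $(s_k)_{k\ge1}$ of $T(\mathcal{E})$ there is a constant $C'$ such that $\|b(s_k)\|\le C'\alpha^k$ for all $k\ge1$.
   Context: For an ordered basis $\mathcal{E}=\{e_1,\dots,e_{n+1}\}$ of $\mathbb{R}^{n+1}$ and $j\in\{1,\dots,n+1\}$, $\mathcal{E}_j=\{e^j_1,\dots,e^j_{n+1}\}$ is the basis with $e^j_j=e_j$ and $e^j_i=e_i+e_j$ for $i\ne j$. For a multi-index $I=i_1i_2\cdots i_k$ with entries in $\{1,\dots,n+1\}$, define recursively $\mathcal{E}_{\emptyset}=\mathcal{E}$ and $\mathcal{E}_{i_1\cdots i_k}=(\mathcal{E}_{i_1\cdots i_{k-1}})_{i_k}$. The bases $\mathcal{E}_I$ form an infinite $(n+1)$-ary rooted tree $T(\mathcal{E})$ with root $\mathcal{E}$, the children of $\mathcal{E}_I$ being $\mathcal{E}_{I1},\dots,\mathcal{E}_{I(n+1)}$. The barycenter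 of a basis $\mathcal{B}=\{f_1,\dots,f_{n+1}\}$ is the vector $b(\mathcal{B})=\sum_{i=1}^{n+1}f_i\in\mathbb{R}^{n+1}$. A section of $T(\mathcal{E})$ is a sequence of nodes in which each element (except the first) is a child of the preceding one. A Fibonacci section is a section obtained by choosing $i_1\in\{1,\dots,n+1\}$ and a sign $\pm$ and setting $t_k=\mathcal{E}_{i_1,\,i_1\pm1,\,i_1\pm2,\,\dots,\,i_1\pm(k-1)}$ for $k\ge1$, where the same sign is used throughout and all indices are taken modulo $n+1$ in $\{1,\dots,n+1\}$. *)

(* Defs.v *)
From mathcomp Require Import all_boot all_order all_algebra.
From mathcomp Require Import reals complex.

Set Implicit Arguments.
Unset Strict Implicit.
Unset Printing Implicit Defensive.

Import Order.TTheory GRing.Theory Num.Theory.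
Local Open Scope ring_scope.

(* An ordered (n+1)-tuple of vectors of R^(n+1).  Positions are 0, ..., n
   instead of 1, ..., n+1. *)
Notation frame R n := (n.+1.-tuple 'rV[R]_n.+1).

Definition child (R : realType) (n : nat) (E : frame R n) (j : 'I_n.+1) :
    frame R n :=
  [tuple if i == j then tnth E j else tnth E i + tnth E j | i < n.+1].

(* foldl processes I from left to right, so
   node E (rcons I j) = child (node E I) j. *)
Definition node (R : realType) (n : nat) (E : frame R n) (I : seq 'I_n.+1) :
    frame R n :=
  foldl (@child R n) E I.

Definition barycenter (R : realType) (n : nat) (E : frame R n) : 'rV[R]_n.+1 :=
  \sum_(i < n.+1) tnth E i.

(* Sequences of nodes are indexed by k >= 1; the value at 0 is irrelevant.
   The first node s 1 may be any node of the tree, not only the root. *)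
Definition is_section (R : realType) (n : nat) (E : frame R n)
    (s : nat -> frame R n) : Prop :=
  (exists I : seq 'I_n.+1, s 1%N = node E I) /\
  (forall k : nat, (1 <= k)%N -> exists j : 'I_n.+1, s k.+1 = child (s k) j).

(* 'I_n.+1 carries addition modulo n+1 (also for n = 0), and inZp m is the
   residue of m; plus selects the sign. *)
Definition fib_index (n : nat) (plus : bool) (i1 : 'I_n.+1) (m : nat) :
    'I_n.+1 :=
  if plus then i1 + inZp m else i1 - inZp m.

Definition is_fibonacci_section (R : realType) (n : nat) (E : frame R n)
    (t : nat -> frame R n) : Prop :=
  exists (i1 : 'I_n.+1) (plus : bool), forall k : nat, (1 <= k)%N ->
    t k = node E [seq fib_index plus i1 m | m <- iota 0 k].

Lemma fibonacci_section_is_section (R : realType) (n : nat) (E : frame R n)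
    (t : nat -> frame R n) :
  is_fibonacci_section E t -> is_section E t.
Proof.
move=> [i1 [plus tE]]; split; first by eexists; exact: tE.
move=> k k1; exists (fib_index plus i1 k).
by rewrite !tE // -[k.+1]addn1 iotaD map_cat /node foldl_cat.
Qed.

Definition is_norm (R : realType) (n : nat) (N : 'rV[R]_n -> R) : Prop :=
  [/\ forall v, 0 <= N v,
      forall v, N v = 0 -> v = 0,
      forall (a : R) v, N (a *: v) = `|a| * N v
    & forall v w, N (v + w) <= N v + N w].

(* alpha is the m-bonacci number: a root of x^m = x^(m-1) + ... + x + 1 whose
   modulus is the largest among all complex roots.  The norm on R[i] takes its
   values in R[i], where <= holds between reals embedded in R[i] iff it holds
   in R. *)
Definition is_bonacci (R : realType) (m : nat) (alpha : R) : Prop :=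
  alpha ^+ m = \sum_(i < m) alpha ^+ i /\
  (forall z : R[i], z ^+ m = \sum_(i < m) z ^+ i -> `|z| <= `|alpha%:C%C|).

(* Main.v *)
Require Import Defs.
From mathcomp Require Import all_boot all_order all_algebra.
From mathcomp Require Import reals complex.
From mathcomp Require Import classical_sets topology normedtype derive.
From mathcomp Require Import zify lra.

Set Implicit Arguments.
Unset Strict Implicit.
Unset Printing Implicit Defensive.

Import Order.TTheory GRing.Theory Num.Theory.
Import numFieldNormedType.Exports.
Local Open Scope ring_scope.

(* The barycenter of E_I has coordinates w = (1, ..., 1) M_k ... M_1 in the root
   basis, where multiplying by M_j replaces the j-th entry of w by the sum of
   all entries.  If the entries of w are bounded by A alpha^(r i) for a
   bijective ranking r, then after replacing entry j they are bounded by
   A alpha^(r' i + 1), where r' gives j the top rank and moves the entries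
   ranked above j down by one: the new entry is at most
   A (1 + alpha + ... + alpha^n) = A alpha^(n+1).  A Fibonacci section always
   replaces the entry of lowest rank, so every other rank drops by exactly one
   and the same argument gives lower bounds.  Both bounds on the coordinates
   carry over to N by equivalence of norms on R^(n+1). *)

(** * Comparison of an arbitrary norm with the sup norm *)

Lemma is_norm0 (R : realType) n (N : 'rV[R]_n -> R) : is_norm N -> N 0 = 0.
Proof. by move=> [_ _ NZ _]; rewrite -(scale0r 0) NZ normr0 mul0r. Qed.

Lemma norm_sum_le (R : realType) n (N : 'rV[R]_n -> R) (I : finType)
    (F : I -> 'rV[R]_n) : is_norm N -> N (\sum_i F i) <= \sum_i N (F i).
Proof.
move=> Nn; have [_ _ _ ND] := Nn.
apply: (big_rec2 (fun x y => N x <= y)) => [|i y x _ le]; first by rewrite is_norm0.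
by apply: le_trans (ND _ _) _; rewrite lerD2l.
Qed.

Lemma coord_le_mx_norm (R : realType) n (v : 'rV[R]_n) i : `|v 0 i| <= `|v|.
Proof.
rewrite [leRHS]/Num.norm /= mx_normrE.
exact: (le_bigmax _ (fun ij : 'I_1 * 'I_n => `|v ij.1 ij.2|) (0, i)).
Qed.

Lemma norm_le_mx_norm (R : realType) n (N : 'rV[R]_n -> R) : is_norm N ->
  forall v, N v <= (\sum_i N (delta_mx 0 i)) * `|v|.
Proof.
move=> Nn v; have [N0 _ NZ _] := Nn.
rewrite {1}(row_sum_delta v); apply: le_trans (norm_sum_le _ Nn) _.
rewrite mulr_suml; apply: ler_sum => i _; rewrite NZ mulrC ler_wpM2l //.
exact: coord_le_mx_norm.
Qed.

Lemma dist_le_continuous (R : realType) (V : normedModType R) (f : V -> R) K :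
  (forall u v, `|f u - f v| <= K * `|u - v|) -> continuous f.
Proof.
move=> f_lip u; apply/(@cvgrPdist_lt R R^o) => e e0; apply/nbhs_normP.
(* [K] has no prescribed sign; [|K| + 1] is positive, so dividing by it is safe. *)
have K1 : 0 < `|K| + 1 by rewrite ltr_wpDl.
exists (e / (`|K| + 1)) => [|v /= uv]; first exact: divr_gt0.
apply: le_lt_trans (f_lip _ _) _; rewrite ltr_pdivlMr // mulrC in uv.
apply: le_lt_trans _ uv; rewrite ler_wpM2r //.
by rewrite (le_trans (ler_norm _)) // lerDl.
Qed.

Lemma is_norm_continuous (R : realType) n (N : 'rV[R]_n -> R) : is_norm N ->
  continuous N.
Proof.
move=> Nn; have [N0 _ NZ ND] := Nn.
have NB u w : N u - N w <= N (u - w) by rewrite lerBlDr -{1}(subrK w u) ND.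
have NC u w : N (u - w) = N (w - u).
  by rewrite -opprB -scaleN1r NZ normrN1 mul1r.
apply: (dist_le_continuous (K := \sum_i N (delta_mx 0 i))) => u w.
apply: le_trans (norm_le_mx_norm Nn _).
by rewrite ler_norml NB andbT lerNl opprB NC NB.
Qed.

(** [N] is continuous, so it attains a minimum on the compact unit sphere of the sup norm. The
    minimum is positive by definiteness and serves as [c]; homogeneity extends the bound to all
    vectors. *)
Lemma is_norm_ge_coord (R : realType) n (N : 'rV[R]_n.+1 -> R) : is_norm N ->
  exists2 c, 0 < c & forall (v : 'rV[R]_n.+1) i, c * `|v 0 i| <= N v.
Proof.
move=> Nn; have [N0 N_eq0 NZ _] := Nn.
pose A := [set v : 'rV[R]_n.+1 | `|v| = 1]%classic.
have normA (v : 'rV[R]_n.+1) : v != 0 -> (`|v|^-1 *: v) \in A.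
  move=> v0; rewrite inE /A /= normrZ normfV normr_id mulVf //.
  by rewrite normr_eq0.
have A0 : (A !=set0)%classic.
  exists (`|const_mx 1 : 'rV[R]_n.+1|^-1 *: const_mx 1); apply: set_mem.
  by apply: normA; apply/eqP => /rowP/(_ 0)/eqP; rewrite !mxE oner_eq0.
have cA : compact A.
  apply: bounded_closed_compact.
    by exists 1; split => // x x1 v /= ->; exact: ltW.
  have -> : A = (Num.norm @^-1` [set x | x = 1 :> R])%classic by [].
  apply: preimage_closed; last exact: closed_eq.
  by move=> v _; exact: norm_continuous.
have [v vA min] :=
  EVT_min_rV A0 cA (continuous_subspaceT (@is_norm_continuous _ _ _ Nn)).
exists (N v).
  rewrite lt_neqAle N0 andbT eq_sym; apply/eqP => /N_eq0 v0.
  by move: vA; rewrite inE /A /= v0 normr0 => /esym/eqP; rewrite oner_eq0.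
move=> w i; have [->|w0] := eqVneq w 0.
  by rewrite mxE normr0 mulr0.
apply: (@le_trans _ _ (N v * `|w|)).
  by rewrite ler_wpM2l // coord_le_mx_norm.
rewrite -ler_pdivlMr ?normr_gt0 // mulrC -[_^-1]ger0_norm ?invr_ge0 // -NZ.
exact/min/normA.
Qed.

(** Transports [N] to coordinates in [E], so that a lower bound on one coordinate of a barycenter
    bounds its norm. Definiteness is where freeness of [E] enters. *)
Lemma is_norm_basis (R : realType) n (N : 'rV[R]_n.+1 -> R)
    (E : n.+1.-tuple 'rV[R]_n.+1) :
  basis_of fullv E -> is_norm N ->
  is_norm (fun w : 'rV[R]_n.+1 => N (\sum_i w 0 i *: tnth E i)).
Proof.
move=> /andP[_ /freeP Efree] [N0 N_eq0 NZ ND]; split => //.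
- move=> w /N_eq0; under eq_bigr do rewrite (tnth_nth 0).
  by move=> /Efree w0; apply/rowP => i; rewrite w0 mxE.
- move=> a w; rewrite -NZ scaler_sumr; congr N.
  by apply: eq_bigr => i _; rewrite mxE scalerA.
- move=> v w; apply: le_trans (ND _ _); rewrite -big_split /=.
  by under eq_bigr do rewrite mxE scalerDl.
Qed.

(** * The bonacci number is real and at least 1 *)

Lemma bonacci_factor (R : comPzRingType) (x : R) m :
  x ^+ m = \sum_(i < m) x ^+ i -> x ^+ m * (2 - x) = 1.
Proof.
(* Multiplying the equation by [x - 1] collapses the geometric sum. *)
move=> xm; have := subrX1 x m; rewrite -xm => e.
have -> : 2 - x = 1 - (x - 1) :> R by rewrite opprB addrA.
by rewrite mulrBr mulr1 mulrC -e opprB addrC subrK.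
Qed.

Lemma exists_bonacci_root (R : realType) m :
  exists2 x : R, 1 <= x & x ^+ m.+1 = \sum_(i < m.+1) x ^+ i.
Proof.
pose p : {poly R} := 'X^(m.+1) - \sum_(i < m.+1) 'X^i.
have pE x : p.[x] = x ^+ m.+1 - \sum_(i < m.+1) x ^+ i.
  by rewrite !hornerE horner_sum; under eq_bigr do rewrite hornerXn.
have p1 : p.[1] <= 0.
  rewrite pE expr1n; under eq_bigr do rewrite expr1n.
  by rewrite sumr_const card_ord subr_le0 ler1n.
(* The powers of 2 below [2 ^+ m.+1] sum to [2 ^+ m.+1 - 1], so [p.[2]] is 1. *)
have p2 : 0 <= p.[2].
  have := subrX1 (2 : R) m.+1; rewrite pE.
  have -> : 2 - 1 = 1 :> R by lra.
  by rewrite mul1r => <-; lra.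
have := @poly_ivt R p 1 2; rewrite ler1n p1 p2 => /(_ isT isT).
move=> [x /andP[x1 _] /rootP/eqP].
by rewrite pE subr_eq0 => /eqP; exists x.
Qed.

(** Maximality of the modulus, compared with a real root that is at least 1, gives only a bound on
    [|alpha|]; the sign has to be settled separately. *)
Lemma bonacci_ge1 (R : realType) m (alpha : R) :
  is_bonacci m.+1 alpha -> 1 <= alpha.
Proof.
move=> [alphaE alpha_max]; have [x x1 xE] := exists_bonacci_root R m.
have : `|x%:C%C| <= `|alpha%:C%C|.
  apply: alpha_max; rewrite -rmorphXn xE rmorph_sum.
  by under eq_bigr do rewrite rmorphXn.
rewrite !normc_def lecR /= expr0n !addr0 !sqrtr_sqr.
rewrite (ger0_norm (le_trans ler01 x1)).
move=> /(le_trans x1); have [alpha_ge0|alpha_lt0] := leP 0 alpha.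
  by rewrite ger0_norm.
rewrite ltr0_norm // => alpha1.
(* A root alpha <= -1 is impossible: |alpha|^(m+1) (2 - alpha) >= 3. *)
have := congr1 (fun y => `|y|) (bonacci_factor alphaE).
rewrite normrM normr1 normrX ltr0_norm // ger0_norm; last by lra.
by have := exprn_ege1 m.+1 alpha1; nra.
Qed.

(** * Coordinates of barycenters and their growth *)

(** The row [w] of the overview. The head of [I] is the first step down from the root, hence the
    last matrix to act on the row. *)
Fixpoint coef (R : nzRingType) (n : nat) (I : seq 'I_n.+1) (i : 'I_n.+1) : R :=
  if I is j :: I' then
    if i == j then \sum_l coef R I' l else coef R I' i
  else 1.

Lemma barycenter_node (R : realType) n (E : frame R n) (I : seq 'I_n.+1) :
  barycenter (node E I) = \sum_i coef R I i *: tnth E i.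
Proof.
elim: I E => [|j I IH] E; first by apply: eq_bigr => i _; rewrite scale1r.
rewrite /= IH (bigD1 j) //= [RHS](bigD1 j) //= eqxx.
rewrite [X in _ = X *: _ + _](bigD1 j) //= scalerDl scaler_suml.
rewrite tnth_mktuple eqxx -addrA -big_split /=.
congr (_ + _); apply: eq_bigr => i /negPf ij.
by rewrite tnth_mktuple ij scalerDr addrC.
Qed.

Lemma coef_ge0 (R : numDomainType) n (I : seq 'I_n.+1) i : 0 <= coef R I i.
Proof.
elim: I i => //= j I IH i; case: ifP => // _; exact: sumr_ge0.
Qed.

Lemma sum_bonacci (R : nzRingType) n (alpha : R) (r : 'I_n.+1 -> 'I_n.+1) :
  alpha ^+ n.+1 = \sum_(i < n.+1) alpha ^+ i -> injective r ->
  \sum_i alpha ^+ r i = alpha ^+ n.+1.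
Proof.
move=> -> r_inj.
by rewrite [RHS](reindex_inj r_inj).
Qed.

(** The new ranking [r'] of the overview. *)
Definition promote n (r : 'I_n.+1 -> 'I_n.+1) (j i : 'I_n.+1) : 'I_n.+1 :=
  if i == j then ord_max else inord (r i - (r j < r i))%N.

Lemma promoteE n (r : 'I_n.+1 -> 'I_n.+1) (j i : 'I_n.+1) :
  promote r j i = (if i == j then n else (r i - (r j < r i)))%N :> nat.
Proof.
rewrite /promote; case: ifP => //= _; rewrite inordK //.
by have := ltn_ord (r i); lia.
Qed.

Lemma promote_inj n (r : 'I_n.+1 -> 'I_n.+1) j :
  injective r -> injective (promote r j).
Proof.
move=> r_inj i k /(congr1 val) /=; rewrite !promoteE.
have [-> | ij] := eqVneq i j; have [-> | kj] := eqVneq k j => // e.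
- have : r k != r j by rewrite (inj_eq r_inj).
  by rewrite -val_eqE /=; have := ltn_ord (r k); have := ltn_ord (r j); lia.
- have : r i != r j by rewrite (inj_eq r_inj).
  by rewrite -val_eqE /=; have := ltn_ord (r i); have := ltn_ord (r j); lia.
- apply/r_inj/val_inj => /=; move: e.
  have : r i != r j by rewrite (inj_eq r_inj).
  have : r k != r j by rewrite (inj_eq r_inj).
  by rewrite -!val_eqE /=; lia.
Qed.

Lemma coef_le (R : numDomainType) n (alpha : R) (I : seq 'I_n.+1) :
  1 <= alpha -> alpha ^+ n.+1 = \sum_(i < n.+1) alpha ^+ i ->
  exists2 r : 'I_n.+1 -> 'I_n.+1, injective r &
    forall i, coef R I i <= alpha ^+ (size I + r i).
Proof.
move=> alpha1 alphaE; elim: I => [|j I [r r_inj coef_r]] /=.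
  by exists id => // i; rewrite exprn_ege1.
exists (promote r j); first exact: promote_inj.
move=> i; rewrite promoteE; case: ifP => [_|ij].
  apply: (@le_trans _ _ (\sum_l alpha ^+ (size I + r l))).
    by apply: ler_sum => l _.
  under eq_bigr do rewrite exprD.
  by rewrite -mulr_sumr sum_bonacci // -exprD addSnnS.
(* An unchanged entry loses at most one rank, which the longer word makes up for. *)
apply: le_trans (coef_r i) _; apply: ler_weXn2l => //.
by have := ltn_ord (r i); lia.
Qed.

(* Modulo n + 1, p + n stands for p - 1: the entry fib_index plus i1 p has rank
   n in the ranking for p and rank 0 in the ranking for p + 1. *)
Definition fib_rank n (plus : bool) (i1 : 'I_n.+1) (p : nat) (i : 'I_n.+1) :
    'I_n.+1 :=
  (if plus then i1 - i else i - i1) + inZp (p + n).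

Lemma fib_rank_inj n plus (i1 : 'I_n.+1) p : injective (fib_rank plus i1 p).
Proof.
by rewrite /fib_rank => x y /addIr; case: plus => [/addrI/oppr_inj|/addIr].
Qed.

(** Passing from [p] to [p.+1] adds 1 modulo [n.+1]; the only wraparound, from [n] to 0, occurs at
    the excluded index. *)
Lemma fib_rankS n plus (i1 : 'I_n.+1) p i : i != fib_index plus i1 p ->
  fib_rank plus i1 p.+1 i = (fib_rank plus i1 p i).+1 :> nat.
Proof.
rewrite /fib_rank; set d : 'I_n.+1 := if _ then _ else _ => ip.
(* [d + inZp p] is the rank plus one modulo [n.+1]. *)
have : (d + inZp p != 0).
  apply: contra ip; rewrite /d /fib_index; case: (plus).
    by rewrite addrAC subr_eq0 eq_sym.
  by rewrite addrAC subr_eq0 => /eqP <-; rewrite addrK.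
rewrite -val_eqE /= !modnDmr.
have -> : (d + (p.+1 + n) = d + p + n.+1)%N by lia.
rewrite modnDr addnA -[in RHS]modnDml.
move: (ltn_pmod (d + p) (ltn0Sn n)); case: (_ %% _)%N => // v vn _.
by rewrite addSnnS modnDr modn_small // ltnW.
Qed.

(** The phase [p] varies because removing the head of the word leaves one that starts at [p.+1]. The
    factor [alpha ^+ n] covers the empty word, whose entries are 1 while ranks go up to [n]. *)
Lemma le_coef_cycle (R : numDomainType) n (alpha : R) (i1 : 'I_n.+1) plus k p i :
  1 <= alpha -> alpha ^+ n.+1 = \sum_(i < n.+1) alpha ^+ i ->
  alpha ^+ (k + fib_rank plus i1 p i) <=
    alpha ^+ n * coef R [seq fib_index plus i1 m | m <- iota p k] i.
Proof.
move=> alpha1 alphaE; elim: k p i => [|k IH] p i; rewrite [coef _ _ _]/=.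
  by rewrite mulr1 add0n ler_weXn2l // -ltnS ltn_ord.
case: ifP => [_|/negbT/fib_rankS e]; last by rewrite addSnnS -e IH.
rewrite mulr_sumr.
apply: (@le_trans _ _ (\sum_l alpha ^+ (k + fib_rank plus i1 p.+1 l))).
  under eq_bigr do rewrite exprD.
  rewrite -mulr_sumr (sum_bonacci alphaE (@fib_rank_inj _ _ _ _)) -exprD.
  by rewrite ler_weXn2l // addSnnS leq_add2l ltn_ord.
by apply: ler_sum => l _; exact: IH.
Qed.

(** Here [l] is the depth of the first node, which may lie anywhere in the tree. *)
Lemma section_node (R : realType) n (E : frame R n) (s : nat -> frame R n) :
  is_section E s ->
  exists l : nat, forall k, exists2 I, size I = (l + k)%N & s k.+1 = node E I.
Proof.
move=> [[I0 s1] sS]; exists (size I0); elim=> [|k [I sizeI sk]].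
  by exists I0; rewrite ?addn0.
have [j sj] := sS k.+1 isT; exists (rcons I j).
  by rewrite size_rcons sizeI addnS.
by rewrite sj sk /node foldl_rcons.
Qed.

Lemma norm_barycenter_le (R : realType) n (E : frame R n)
    (N : 'rV[R]_n.+1 -> R) (alpha : R) (I : seq 'I_n.+1) :
  is_norm N -> 1 <= alpha -> alpha ^+ n.+1 = \sum_(i < n.+1) alpha ^+ i ->
  N (barycenter (node E I)) <=
    (\sum_i N (tnth E i)) * alpha ^+ n * alpha ^+ size I.
Proof.
move=> Nn alpha1 alphaE; have [N0 _ NZ _] := Nn.
have [r _ coef_r] := coef_le I alpha1 alphaE.
rewrite barycenter_node; apply: le_trans (norm_sum_le _ Nn) _.
rewrite -mulrA mulr_suml; apply: ler_sum => i _.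
rewrite NZ ger0_norm ?coef_ge0 // mulrC ler_wpM2l // -exprD.
apply: le_trans (coef_r i) _; rewrite addnC ler_weXn2l // leq_add2r.
by rewrite -ltnS ltn_ord.
Qed.

Theorem theorem2 (R : realType) (n : nat) (E : n.+1.-tuple 'rV[R]_n.+1)
    (N : 'rV[R]_n.+1 -> R) (alpha : R)
    (hE : basis_of fullv E) (hN : is_norm N) (halpha : is_bonacci n.+1 alpha) :
  (forall t : nat -> n.+1.-tuple 'rV[R]_n.+1, is_fibonacci_section E t ->
     exists c C : R, [/\ 0 < c, c <= C &
       forall k : nat, (1 <= k)%N ->
         c * alpha ^+ k <= N (barycenter (t k)) <= C * alpha ^+ k])
  /\
  (forall s : nat -> n.+1.-tuple 'rV[R]_n.+1, is_section E s ->
     exists C' : R, forall k : nat, (1 <= k)%N ->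
       N (barycenter (s k)) <= C' * alpha ^+ k).
Proof.
have alpha1 := bonacci_ge1 halpha; have [alphaE _] := halpha.
have alpha_gt0 : 0 < alpha := lt_le_trans ltr01 alpha1.
have [N0 _ _ _] := hN.
set K := \sum_i N (tnth E i).
have K0 : 0 <= K by exact: sumr_ge0.
split=> [t [i1 [plus tE]]|s /section_node[l s_node]].
  have [c c0 ge_c] := is_norm_ge_coord (is_norm_basis hE hN).
  have bounds k : (1 <= k)%N -> c / alpha ^+ n * alpha ^+ k
      <= N (barycenter (t k)) <= K * alpha ^+ n * alpha ^+ k.
    move=> k1; rewrite tE //; set I := [seq _ | m <- _].
    have sizeI : size I = k by rewrite size_map size_iota.
    have := norm_barycenter_le E I hN alpha1 alphaE.
    rewrite sizeI => ->; rewrite andbT barycenter_node.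
    (* One coordinate is enough for the lower bound; [i1] is merely a convenient choice. *)
    have := ge_c (\row_i coef R I i) i1; rewrite mxE ger0_norm ?coef_ge0 //.
    under eq_bigr do rewrite mxE.
    apply: le_trans; rewrite -mulrA ler_pM2l // ler_pdivrMl ?exprn_gt0 //.
    apply: le_trans (le_coef_cycle i1 plus k 0 i1 alpha1 alphaE).
    by rewrite ler_weXn2l // leq_addr.
  exists (c / alpha ^+ n), (K * alpha ^+ n); split=> //.
    by rewrite divr_gt0 ?exprn_gt0.
  (* The order of the two constants follows from the bounds at [k = 1]. *)
  have /andP[le1 le2] := bounds 1%N isT.
  by have := le_trans le1 le2; rewrite ler_pM2r // exprn_gt0.
exists (K * alpha ^+ n * alpha ^+ l) => -[//|k] _.
have [I sizeI ->] := s_node k.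
apply: le_trans (norm_barycenter_le E I hN alpha1 alphaE) _.
rewrite -[leRHS]mulrA -exprD sizeI addnS.
(* The node [s k.+1] has depth [l + k], one less than the exponent allowed. *)
apply: ler_wpM2l; last by rewrite ler_weXn2l.
by rewrite mulr_ge0 // exprn_ge0 // ltW.
Qed.
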